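(* Let $k,l$ be positive integers. Let $G=(V,E)$ be a graph on more than $k$ vertices such that every vertex subset $S\subseteq V$ with $|S|=k$ satisfies $|N_G(S)|\ge l$. Then $G$ contains a path of length $l$.
   Context: For a vertex set $S$, $N_G(S)=\{v\in V\setminus S: v \text{ has a neighbor in } S\}$ denotes the external neighborhood of $S$. Path lengths are measured in edges. *)

(* Defs.v *)
From mathcomp Require Import all_boot.

Set Implicit Arguments.
Unset Strict Implicit.
Unset Printing Implicit Defensive.

(* A finite simple graph is a symmetric irreflexive adjacency relation on its *)
(* finType of vertices.                                                       *)

Definition ext_nbhd (V : finType) (adj : rel V) (S : {set V}) : {set V} :=
  [set v in ~: S | [exists u in S, adj v u]].

(* Length counts edges: the path visits size p + 1 distinct vertices x :: p. *)
Definition has_path_of_length (V : finType) (adj : rel V) (l : nat) : Prop :=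
  exists (x : V) (p : seq V), [/\ path adj x p, uniq (x :: p) & size p = l].

(* Main.v *)
Require Import Defs.
From mathcomp Require Import all_boot.

(** Depth-first search.  At every moment the vertices split into the finished
    set [D], the stack [s], which is a path, and the unvisited vertices, and no
    edge joins [D] to an unvisited vertex, so [N(D)] is contained in [s].
    Consider the moment at which the [k]-th vertex [x] is finished: the
    remaining stack contains [N(D)], hence at least [l] vertices, and together
    with [x], which was on top of it, it forms a path with at least [l] edges. *)

Definition dfs_state (V : finType) (adj : rel V) (D : {set V}) (s : seq V) :=
  [/\ uniq s, sorted adj s, {in s, forall x, x \notin D}
    & {subset ext_nbhd adj D <= s}].

Lemma mem_ext_nbhd (V : finType) (adj : rel V) (D : {set V}) (u v : V) :
  v \notin D -> u \in D -> adj v u -> v \in ext_nbhd adj D.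
Proof.
by move=> vD uD vu; rewrite !inE vD; apply/existsP; exists u; rewrite uD.
Qed.

Lemma dfs_push (V : finType) (adj : rel V) (D : {set V}) (s : seq V) (y : V) :
  dfs_state V adj D s -> y \notin D -> y \notin s -> sorted adj (y :: s) ->
  dfs_state V adj D (y :: s).
Proof.
case=> us _ sD Ns yD ys sort_ys; split=> //; first by rewrite /= ys.
- by move=> z; rewrite inE => /predU1P[->|/sD].
- by move=> z /Ns; rewrite inE orbC => ->.
Qed.

(** An outside neighbour of [x |: D] is adjacent to [x], hence on the stack by [closed_x], or lies
    in [ext_nbhd adj D], hence on the stack by the invariant; being distinct from [x], it is in
    [s]. *)
Lemma dfs_pop (V : finType) (adj : rel V) (D : {set V}) (x : V) (s : seq V) :
  dfs_state V adj D (x :: s) ->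
  (forall y, adj y x -> y \notin D -> y \in x :: s) ->
  dfs_state V adj (x |: D) s.
Proof.
case=> /andP[xs us] sort_xs sD Ns closed_x; split=> //.
- exact: path_sorted sort_xs.
- move=> z zs; rewrite !inE negb_or sD ?inE ?zs ?orbT // andbT.
  by apply: contraNneq xs => <-.
- move=> z; rewrite !inE negb_or => /andP[/andP[zx zD]] /existsP[u].
  rewrite !inE => /andP[/predU1P[->|uD] zu].
    by have := closed_x z zu zD; rewrite inE (negPf zx).
  by have := Ns z (mem_ext_nbhd V adj D u z zD uD zu); rewrite inE (negPf zx).
Qed.

(** Until the next pop the search only pushes: [D] stays fixed while the stack, being
    duplicate-free, can grow to at most [#|V|] vertices. So a pop must come, and the popped [x]
    still extends the remaining stack to a path. *)
Lemma dfs_finish_next (V : finType) (adj : rel V) (D : {set V}) (s : seq V) :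
  #|D| < #|V| -> dfs_state V adj D s ->
  exists (x : V) (D' : {set V}) (s' : seq V),
    [/\ #|D'| = #|D|.+1, uniq (x :: s'), path adj x s' & dfs_state V adj D' s'].
Proof.
move=> ltDV; have [n] := ubnP (#|V| - size s).
elim: n s => // n IHn s lt_n st.
have size_push y : y \notin s -> #|V| - size (y :: s) < n.
  (* Truncated subtraction decreases strictly only because [size s < #|V|]. *)
  move=> ys; rewrite ltnS in lt_n; apply: leq_trans lt_n; apply: ltn_sub2l => //.
  have us : uniq (y :: s) by case: st => us _ _ _; rewrite /= ys.
  by have := max_card (mem (y :: s)); rewrite (card_uniqP us).
case: s lt_n st size_push => [|x s] lt_n st size_push.
  (* With an empty stack, the search restarts at any unfinished vertex. *)
  have /existsP[y yD] : [exists y, y \notin D].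
    rewrite -negb_forall; apply: contraTN ltDV => /forallP DV.
    by rewrite -leqNgt; apply: subset_leq_card; apply/subsetP => z _; apply: DV.
  exact: IHn (size_push y _) (dfs_push _ _ _ _ _ st yD _ _).
have [y /and3P[yx yD ys]|closed_x] :=
    pickP (fun y => [&& adj y x, y \notin D & y \notin x :: s]).
  apply: IHn (size_push y ys) (dfs_push _ _ _ _ _ st yD ys _).
  by case: st => _ sort_xs _ _; rewrite /= yx.
exists x, (x |: D), s; case: (st) => us sort_xs sD _; split=> //.
  by rewrite cardsU1 sD ?mem_head.
apply: dfs_pop st _ => y yx yD.
by have := closed_x y; rewrite yx yD => /negbFE.
Qed.

Lemma dfs_finished_card (V : finType) (adj : rel V) (n : nat) :
  n <= #|V| ->
  exists (D : {set V}) (s : seq V), #|D| = n /\ dfs_state V adj D s.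
Proof.
elim: n => [|n IHn] le_nV.
  exists set0, [::]; split; first exact: cards0.
  split=> // z; rewrite !inE => /existsP[u].
  by rewrite inE.
have [D [s [cardD st]]] := IHn (ltnW le_nV); rewrite -cardD in le_nV *.
have [_ [D' [s' [cardD' _ _ st']]]] :=
  dfs_finish_next V adj D s le_nV st.
by exists D', s'.
Qed.

Theorem proposition2p1 (k l : nat) (V : finType) (adj : rel V)
  (k_gt0 : 0 < k) (l_gt0 : 0 < l)
  (adj_sym : symmetric adj) (adj_irr : irreflexive adj)
  (card_V : k < #|V|)
  (expand : forall S : {set V}, #|S| = k -> l <= #|ext_nbhd adj S|) :
  has_path_of_length adj l.
Proof.
case: k k_gt0 card_V expand => // k _ card_V expand.
have lt_kV := ltnW card_V.
(* Here [k] is one less than the original, so the next vertex finished after [D0] completes a set to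
   which [expand] applies. *)
have [D0 [s0 [card_D0 st0]]] := dfs_finished_card V adj k (ltnW lt_kV).
rewrite -card_D0 in lt_kV.
have [x [D [s [card_D us path_s [_ _ _ Ns]]]]] :=
  dfs_finish_next V adj D0 s0 lt_kV st0.
rewrite card_D0 in card_D.
have le_ls : l <= size s.
  apply: leq_trans (expand D card_D) _; apply: leq_trans (card_size s).
  by apply: subset_leq_card; apply/subsetP.
exists x, (take l s); split; first exact: take_path.
(* [take l.+1 (x :: s)] reduces to [x :: take l s]. *)
- by have := take_uniq l.+1 us.
- exact: size_takel.
Qed.
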